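(* Let $n \in \mathbb{N}$, $n\ge 1$, and let $\gamma$ be a weight with domain containing $\{0,1,\ldots,n-1\}$. Suppose that either (i) $\gamma_{[0,x]} > 0$ and $\gamma_{[x,n-1]} > 0$ for all $x \in \{0,\ldots,n-1\}$; or (ii) $\gamma_{[x,x]} > 0$ for all $x \in \{0,\ldots,n-1\}$ and $\gamma_{[x-1,x]} > 0$ for all non-zero $x \in \{0,\ldots,n-1\}$. Then the $\gamma$-weighted involutive walk on $\{0,1,\ldots,n-1\}$ is irreducible, recurrent and ergodic with a unique invariant distribution.
   Context: For $x,y\in\mathbb{N}_0$, $[y,x]$ denotes the interval $\{y,y+1,\ldots,x\}\subseteq\mathbb{N}_0$ (empty if $y>x$). A weight with domain $D$, where $D=\mathbb{N}_0$ or $D=\{0,1,\ldots,N-1\}$, is a function $\gamma$ on the set of intervals of $D$, taking non-negative real values $\gamma_{[y,x]}$, with $\gamma_\varnothing = 0$ and $\sum_{y=0}^{x}\gamma_{[y,x]}>0$ for all $x\in D$. Write $N(\gamma)_x=\sum_{y=0}^x\gamma_{[y,x]}$. For $x \in\{0,\ldots,n-1\}$ write $x^\star = n-1-x$. The $\gamma$-weighted involutive walk on $\{0,\ldots,n-1\}$ is the Markov chain in which, from state $x$, one chooses $y\in\{0,\ldots,x\}$ with probability $\gamma_{[y,x]}/N(\gamma)_x$ and steps to $y^\star$. Thus its transition matrix is $P(\gamma)_{xz}=\gamma_{[z^\star,x]}/N(\gamma)_x$ (rows and columns numbered from $0$). Ergodic means that the chain is irreducible and aperiodic, so that from any initial state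 its distribution converges to the invariant distribution. *)

(* Defs.v *)
From HB Require Import structures.
From mathcomp Require Import all_boot all_order all_algebra.
From mathcomp Require Import all_classical all_reals all_analysis.

Set Implicit Arguments.
Unset Strict Implicit.
Unset Printing Implicit Defensive.

Import Order.TTheory GRing.Theory Num.Theory.
Import numFieldNormedType.Exports.

Local Open Scope classical_set_scope.
Local Open Scope ring_scope.

Inductive weight_domain := Naturals | Initial of nat.

Definition in_domain (D : weight_domain) (x : nat) : bool :=
  if D is Initial N then (x < N)%N else true.

(* The interval [y, x] is encoded by its endpoints: [wt y x] is the weight of
   [y, x].  All the pairs with x < y encode the empty interval, hence
   [wt_empty].  The values at x outside of D with y <= x are irrelevant. *)
Record weight (R : realType) (D : weight_domain) := Weight {
  wt :> nat -> nat -> R ;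
  wt_ge0 : forall y x, (y <= x)%N -> in_domain D x -> 0 <= wt y x ;
  wt_empty : forall y x, (x < y)%N -> wt y x = 0 ;
  wt_sum_gt0 : forall x, in_domain D x ->
    0 < \sum_(0 <= y < x.+1) wt y x }.

Definition weight_total (R : realType) (D : weight_domain) (gamma : weight R D)
  (x : nat) : R := \sum_(0 <= y < x.+1) gamma y x.

(* [rev_ord z] has value n - z.+1, i.e. it is the involution n - 1 - z. *)
Definition involutive_walk (R : realType) (D : weight_domain)
    (gamma : weight R D) (n : nat) : 'M[R]_n :=
  \matrix_(x < n, z < n) (gamma (rev_ord z) x / weight_total gamma x).

Definition irreducible (R : realType) (n : nat) (P : 'M[R]_n) : Prop :=
  forall x z : 'I_n, exists k : nat, 0 < (P ^+ k) x z.

(* d is the greatest common divisor of the possible return times to x. *)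
Definition has_period (R : realType) (n : nat) (P : 'M[R]_n) (x : 'I_n)
    (d : nat) : Prop :=
  forall e : nat, (e %| d)%N <->
    (forall k : nat, (0 < k)%N -> 0 < (P ^+ k) x x -> (e %| k)%N).

Definition aperiodic (R : realType) (n : nat) (P : 'M[R]_n) : Prop :=
  forall x : 'I_n, has_period P x 1.

Definition ergodic (R : realType) (n : nat) (P : 'M[R]_n) : Prop := irreducible P /\ aperiodic P.

(* Probability that the chain started at x next visits the states in s, in
   this order. *)
Fixpoint path_prob (R : realType) (n : nat) (P : 'M[R]_n) (x : 'I_n)
    (s : seq 'I_n) : R :=
  if s is y :: s' then P x y * path_prob P y s' else 1.

(* Probability that the first return to x occurs at time k + 1. *)
Definition first_return_prob (R : realType) (n : nat) (P : 'M[R]_n) (x : 'I_n)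
    (k : nat) : R :=
  \sum_(s : k.-tuple 'I_n | x \notin s) path_prob P x (rcons s x).

(* From each state, the chain almost surely returns to that state. *)
Definition recurrent (R : realType) (n : nat) (P : 'M[R]_n) : Prop :=
  forall x : 'I_n, series (first_return_prob P x) @ \oo --> (1 : R).

Definition distribution_vec (R : realType) (n : nat) (pi : 'rV[R]_n) : Prop :=
  (forall x, 0 <= pi 0 x) /\ \sum_x pi 0 x = 1.

Definition invariant_distribution (R : realType) (n : nat) (P : 'M[R]_n)
    (pi : 'rV[R]_n) : Prop :=
  distribution_vec pi /\ pi *m P = pi.

Definition converges_from_every_state (R : realType) (n : nat) (P : 'M[R]_n)
    (pi : 'rV[R]_n) : Prop :=
  forall x z : 'I_n, (fun k : nat => (P ^+ k) x z) @ \oo --> pi 0 z.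

(* Main.v *)
(* Each hypothesis makes the walk primitive, i.e. some power of its matrix is
   entrywise positive.  Under (i) every state steps to n-1 and n-1 steps to every
   state; under (ii) neighbouring states are linked in two steps and the middle
   state has a loop.  For a primitive matrix, P^m with entries at least e > 0
   contracts the l1 norm on vectors of sum zero, which gives convergence and
   uniqueness; it also bounds by 1 - e the probability of avoiding a given state
   for m steps, so that avoidance probabilities decay geometrically, which gives
   recurrence. *)

Require Import Defs.
From HB Require Import structures.
From mathcomp Require Import all_boot all_order all_algebra.
From mathcomp Require Import all_classical all_reals all_analysis.
From mathcomp Require Import zify.

Set Implicit Arguments.
Unset Strict Implicit.
Unset Printing Implicit Defensive.

Import Order.TTheory GRing.Theory Num.Theory.
Import numFieldNormedType.Exports.

Local Open Scope classical_set_scope.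
Local Open Scope ring_scope.

(** * Powers of stochastic matrices and primitivity *)

Definition stochastic (R : realType) (n : nat) (P : 'M[R]_n) : Prop :=
  (forall x y, 0 <= P x y) /\ (forall x, \sum_y P x y = 1).

Lemma expr_mxE (R : pzRingType) (n : nat) (P : 'M[R]_n) j k x z :
  (P ^+ (j + k)) x z = \sum_y (P ^+ j) x y * (P ^+ k) y z.
Proof. by rewrite exprD -mulmxE mxE. Qed.

Section Stochastic.
Variables (R : realType) (n : nat) (P : 'M[R]_n).
Hypothesis stP : stochastic P.

Lemma stochastic_expr k : stochastic (P ^+ k).
Proof.
have [P0 P1] := stP; elim: k => [|k [IH0 IH1]].
  split=> [x y|x]; first by rewrite expr0 mxE; case: eqP.
  rewrite expr0 (bigD1 x) //= big1 ?mxE ?eqxx ?addr0 // => y yx.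
  by rewrite mxE eq_sym (negbTE yx).
split=> [x y|x].
  by rewrite exprS -mulmxE mxE sumr_ge0 // => z _; rewrite mulr_ge0.
under eq_bigr do rewrite exprS -mulmxE mxE.
rewrite exchange_big /= -[RHS](P1 x); apply: eq_bigr => z _.
by rewrite -mulr_sumr IH1 mulr1.
Qed.

Lemma stochastic_le1 x y : P x y <= 1.
Proof.
have [P0 P1] := stP.
by rewrite -(P1 x) (bigD1 y) //= lerDl sumr_ge0.
Qed.

Lemma expr_gt0D j k x y z :
  0 < (P ^+ j) x y -> 0 < (P ^+ k) y z -> 0 < (P ^+ (j + k)) x z.
Proof.
move=> xy yz; rewrite expr_mxE (bigD1 y) //=.
apply: ltr_wpDr; last by rewrite mulr_gt0.
by apply: sumr_ge0 => i _; rewrite mulr_ge0 ?(stochastic_expr _).1.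
Qed.

Lemma expr_gt0_loop c k : 0 < P c c -> 0 < (P ^+ k) c c.
Proof.
move=> cc; elim: k => [|k IH]; first by rewrite expr0 mxE eqxx.
by rewrite -addn1; apply: expr_gt0D IH _; rewrite expr1.
Qed.

(** A zero entry in the next power would force a whole row of [P] to vanish, although that row sums
    to 1. *)
Lemma expr_gt0_total k :
  (forall x z, 0 < (P ^+ k) x z) -> forall x z, 0 < (P ^+ k.+1) x z.
Proof.
move=> Pk x z; rewrite -add1n expr_mxE lt_neqAle.
have Pxy0 y : 0 <= (P ^+ 1) x y * (P ^+ k) y z.
  by rewrite expr1 mulr_ge0 ?(stP.1 x y) // ltW.
rewrite sumr_ge0 // andbT eq_sym; apply/negP => /eqP s0.
have : \sum_y P x y = 0.
  apply: big1 => y _.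
  have /eqP := psumr_eq0P (fun i _ => Pxy0 i) s0 (i := y) isT.
  by rewrite expr1 mulf_eq0 (gt_eqF (Pk y z)) orbF // => /eqP.
by rewrite stP.2 => /eqP; rewrite oner_eq0.
Qed.

(** Any two states are joined through [c], where waiting on the loop pads all paths to one common
    length. *)
Lemma irreducible_loop_primitive c :
  irreducible P -> 0 < P c c -> exists m, forall x z, 0 < (P ^+ m.+1) x z.
Proof.
move=> irr cc.
have [a aP] := choice (fun x => irr x c).
have [b bP] := choice (fun z => irr c z).
(* The two sums dominate every [a x] and [b z]; the surplus is spent on the loop. [expr_gt0_total]
   turns the exponent into a successor. *)
exists ((\sum_x a x) + \sum_x b x)%N; apply: expr_gt0_total => x z.
have ax : (a x <= \sum_x a x)%N by rewrite (bigD1 x) //= leq_addr.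
have bz : (b z <= \sum_x b x)%N by rewrite (bigD1 z) //= leq_addr.
have -> : (\sum_x a x + \sum_x b x = a x +
    ((\sum_x a x - a x) + (\sum_x b x - b z) + b z))%N by lia.
by apply: expr_gt0D (aP x) _; apply: expr_gt0D (bP z); apply: expr_gt0_loop.
Qed.

(** Both [m.+1] and [m.+2] are return times of every state, so a common divisor of the return times
    divides 1. *)
Lemma primitive_ergodic m : (forall x z, 0 < (P ^+ m) x z) -> ergodic P.
Proof.
move=> Pm; split=> [x z|x e]; first by exists m.
split=> [|ek]; first by rewrite dvdn1 => /eqP -> k _ _; rewrite dvd1n.
have e1 := ek m.+1 isT (expr_gt0_total Pm x x).
have e2 := ek m.+2 isT (expr_gt0_total (expr_gt0_total Pm) x x).
by rewrite -(dvdn_addr _ e1) addn1.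
Qed.

End Stochastic.

(** * Uniform lower bounds, geometric decay, sums over tuples *)

Lemma positive_matrix_lbound (R : realType) (n : nat) (Q : 'M[R]_n) :
  (forall x z, 0 < Q x z) ->
  exists2 e : R, 0 < e <= 1 & forall x z, e <= Q x z.
Proof.
(* The default value 1 of the minimum ensures [e <= 1] and covers the empty matrix. *)
move=> Q0; exists (\big[Num.min/1]_(p : 'I_n * 'I_n) Q p.1 p.2).
  by rewrite bigmin_le_id andbT lt_bigmin.
by move=> x z; exact: (bigmin_le 1 (x, z) (fun p : 'I_n * 'I_n => Q p.1 p.2)).
Qed.

(** By monotonicity, a bound at one multiple of [m] controls all later terms. *)
Lemma cvg0_geometric_subseq (R : realType) (a : nat -> R) (m : nat) (C r : R) :
  (forall k, 0 <= a k) -> (forall k, a k.+1 <= a k) -> 0 <= r < 1 ->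
  (forall j, a (m * j)%N <= C * r ^+ j) -> a @ \oo --> (0 : R).
Proof.
move=> a0 aS /andP[r0 r1] am.
have adec : nonincreasing_seq a by apply/nonincreasing_seqP.
have : (fun j => C * r ^+ j) @ \oo --> C * 0.
  by apply: cvgMr; apply: cvg_expr; rewrite ger0_norm.
rewrite mulr0 => /cvgrPdist_lt cr; apply/cvgrPdist_lt => e e0.
have [j _ /(_ j (leqnn j))] := cr e e0.
rewrite /= sub0r normrN => Crj; exists (m * j)%N => // k /= mk.
rewrite sub0r normrN ger0_norm //.
by apply: le_lt_trans Crj; rewrite (le_trans (adec _ _ mk)) // ler_normr am.
Qed.

(** Splitting off the head allows sums over paths to be conditioned on the first step. *)
Lemma big_tuple_cons (R : Type) (idx : R) (op : Monoid.com_law idx)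
    (T : finType) (k : nat) (Q : pred (k.+1.-tuple T))
    (F : k.+1.-tuple T -> R) :
  \big[op/idx]_(s | Q s) F s =
    \big[op/idx]_(z : T) \big[op/idx]_(s : k.-tuple T | Q [tuple of z :: s])
      F [tuple of z :: s].
Proof.
rewrite pair_big_dep /=.
rewrite (reindex (fun p : T * k.-tuple T => [tuple of p.1 :: p.2])) //=.
exists (fun s : k.+1.-tuple T => (thead s, [tuple of behead s])) => [[z s] _|s _].
  by congr (_, _); apply: val_inj.
by rewrite -tuple_eta.
Qed.

(** * Avoidance probabilities and recurrence *)

Section Return.
Variables (R : realType) (n : nat) (P : 'M[R]_n) (x : 'I_n).
Hypothesis stP : stochastic P.

(* Probability that the chain started at y is not at x at any time
   in 1, ..., k. *)
Fixpoint avoid_prob (k : nat) (y : 'I_n) : R :=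
  if k is k'.+1 then \sum_(z | z != x) P y z * avoid_prob k' z else 1.

Lemma avoid_prob_ge0 k y : 0 <= avoid_prob k y.
Proof.
elim: k y => [|k IH] y //=.
by rewrite sumr_ge0 // => z _; rewrite mulr_ge0 ?stP.1.
Qed.

Lemma avoid_prob1 y : avoid_prob 1 y = 1 - P y x.
Proof.
rewrite -[X in X - _](stP.2 y) [X in X - _](bigD1 x) //= addrAC subrr add0r.
by apply: eq_bigr => z _; rewrite mulr1.
Qed.

(** Markov property at time [j]: wherever the chain then is, avoiding [x] for [k] further steps has
    probability at most [C]. *)
Lemma avoid_prob_submul j k C :
  (forall y, avoid_prob k y <= C) ->
  forall y, avoid_prob (j + k) y <= avoid_prob j y * C.
Proof.
move=> kC; elim: j => [|j IH] y /=; first by rewrite mul1r.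
rewrite mulr_suml ler_sum // => z _.
by rewrite -mulrA ler_wpM2l ?stP.1.
Qed.

Lemma avoid_prob_le1 k y : avoid_prob k y <= 1.
Proof.
elim: k y => [|k IH] y //.
have := avoid_prob_submul 1 IH y; rewrite add1n mulr1.
by move/le_trans; apply; rewrite avoid_prob1 lerBlDr lerDl stP.1.
Qed.

Lemma avoid_probS_le k y : avoid_prob k.+1 y <= avoid_prob k y.
Proof.
have := avoid_prob_submul k (avoid_prob_le1 1) y.
by rewrite addn1 mulr1.
Qed.

(* Being at x at time m.+1 precludes avoiding x. *)
Lemma avoid_prob_hit m y : avoid_prob m.+1 y + (P ^+ m.+1) y x <= 1.
Proof.
elim: m y => [|m IH] y; first by rewrite avoid_prob1 expr1 subrK.
rewrite -[in (P ^+ _)]add1n expr_mxE expr1 -[leRHS](stP.2 y).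
rewrite [leRHS](bigD1 x) //= [X in _ + X](bigD1 x) //= addrCA -big_split /=.
apply: lerD.
  by rewrite ler_piMr ?stP.1 // stochastic_le1 //; exact: stochastic_expr.
by apply: ler_sum => z _; rewrite -mulrDr ler_piMr ?stP.1 // IH.
Qed.

Lemma avoid_prob_cvg0 m y :
  (forall y z, 0 < (P ^+ m.+1) y z) -> avoid_prob ^~ y @ \oo --> (0 : R).
Proof.
move=> /positive_matrix_lbound[e /andP[e0 e1] eP].
apply: (@cvg0_geometric_subseq _ _ m.+1 1 (1 - e)).
- by move=> k; apply: avoid_prob_ge0.
- by move=> k; apply: avoid_probS_le.
- by rewrite subr_ge0 e1 ltrBlDr ltrDl.
move=> j; rewrite mul1r; elim: j y => [|j IH] y; first by rewrite muln0.
(* A further block of [m.+1] steps contributes a factor at most [1 - e], by [avoid_prob_hit]. *)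
rewrite mulnS (le_trans (avoid_prob_submul _ IH y)) // exprS.
rewrite ler_wpM2r ?exprn_ge0 ?subr_ge0 // lerBrDr.
by rewrite (le_trans _ (avoid_prob_hit m y)) // lerD2l.
Qed.

(** A first hit at time [k.+1] means avoiding [x] for [k] steps but not for [k.+1]. *)
Lemma first_hit_prob k y :
  \sum_(s : k.-tuple 'I_n | x \notin s) path_prob P y (rcons s x) =
  avoid_prob k y - avoid_prob k.+1 y.
Proof.
elim: k y => [|k IH] y.
  rewrite avoid_prob1 (big_pred1 [tuple]) /=; last first.
    by move=> s; apply/idP/eqP => _; rewrite tuple0.
  by rewrite mulr1 subKr.
rewrite big_tuple_cons /= -sumrB big_mkcond [RHS]big_mkcond /=.
rewrite [LHS]big_mkcond /=.
(* Conditioning on the first state [z]: for [z = x] both sides vanish. *)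
apply: eq_bigr => z _; have [->|zx] := eqVneq z x.
  by apply: big1 => s; rewrite in_cons eqxx.
rewrite -mulrBr -IH mulr_sumr; apply: eq_bigl => s.
by rewrite in_cons eq_sym (negbTE zx).
Qed.

(** By [first_hit_prob] the sum telescopes. *)
Lemma series_first_return_prob k :
  series (first_return_prob P x) k = 1 - avoid_prob k x.
Proof.
rewrite seriesEnat /=; elim: k => [|k IH]; first by rewrite big_geq ?subrr.
rewrite big_nat_recr //= IH /first_return_prob first_hit_prob /=.
by rewrite addrA subrK.
Qed.

End Return.

Lemma primitive_recurrent (R : realType) (n : nat) (P : 'M[R]_n) m :
  stochastic P -> (forall x z, 0 < (P ^+ m.+1) x z) -> recurrent P.
Proof.
move=> stP Pm x.
have -> : series (first_return_prob P x) = (fun k => 1 - avoid_prob P x k x).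
  by apply/funext => k; exact: series_first_return_prob.
rewrite -[X in _ --> X]subr0; apply: cvgB; first exact: cvg_cst.
exact: avoid_prob_cvg0 Pm.
Qed.

(** * Contraction of the l1 norm on vectors of sum zero *)

Section Invariant.
Variables (R : realType) (n : nat) (P : 'M[R]_n).
Hypothesis stP : stochastic P.

Definition l1norm (v : 'rV[R]_n) : R := \sum_x `|v 0 x|.

Lemma sum_mulmx_stochastic (v : 'rV[R]_n) :
  \sum_z (v *m P) 0 z = \sum_z v 0 z.
Proof.
under eq_bigr do rewrite mxE.
rewrite exchange_big; apply: eq_bigr => x _ /=.
by rewrite -mulr_sumr stP.2 mulr1.
Qed.

(** As [v] has sum zero, subtracting [e] from every entry of [P] leaves [v *m P] unchanged; what
    remains is non-negative with row sums [1 - e *+ n]. *)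
Lemma l1norm_contract (e : R) (v : 'rV[R]_n) :
  0 <= e -> (forall x z, e <= P x z) -> \sum_x v 0 x = 0 ->
  l1norm (v *m P) <= (1 - e *+ n) * l1norm v.
Proof.
move=> e0 eP v0.
have vPE z : (v *m P) 0 z = \sum_x v 0 x * (P x z - e).
  under [RHS]eq_bigr do rewrite mulrBr.
  by rewrite sumrB -mulr_suml v0 mul0r subr0 mxE.
have -> : (1 - e *+ n) * l1norm v = \sum_z \sum_x `|v 0 x| * (P x z - e).
  rewrite exchange_big /= mulr_sumr; apply: eq_bigr => x _.
  by rewrite -mulr_sumr sumrB stP.2 sumr_const card_ord mulrC.
apply: ler_sum => z _; rewrite vPE (le_trans (ler_norm_sum _ _ _)) //.
by apply: ler_sum => x _; rewrite normrM [`|P x z - e|]ger0_norm ?subr_ge0.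
Qed.

Lemma l1norm_nonexpansive (v : 'rV[R]_n) : \sum_x v 0 x = 0 ->
  l1norm (v *m P) <= l1norm v.
Proof.
move=> v0; have := l1norm_contract (lexx 0) stP.1 v0.
by rewrite mul0rn subr0 mul1r.
Qed.

End Invariant.

(** * Convergence, existence and uniqueness of the invariant distribution *)

Section Convergence.
Variables (R : realType) (n : nat) (P : 'M[R]_n) (m : nat).
Hypotheses (stP : stochastic P) (Pm : forall x z, 0 < (P ^+ m.+1) x z).

Lemma l1norm_expr_cvg0 (v : 'rV[R]_n) : (0 < n)%N -> \sum_x v 0 x = 0 ->
  (fun k => l1norm (v *m P ^+ k)) @ \oo --> (0 : R).
Proof.
move=> n0 v0; have [e /andP[e0 e1] eP] := positive_matrix_lbound Pm.
have sumk k : \sum_x (v *m P ^+ k) 0 x = 0.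
  by rewrite sum_mulmx_stochastic //; exact: stochastic_expr.
have l0 w : 0 <= l1norm w :> R by apply: sumr_ge0.
apply: (@cvg0_geometric_subseq _ _ m.+1 (l1norm v) (1 - e)) => //.
- by move=> k; rewrite exprSr -mulmxE mulmxA l1norm_nonexpansive.
- by rewrite subr_ge0 e1 ltrBlDr ltrDl.
elim=> [|j IH]; first by rewrite muln0 expr0 mulr1 mulmx1.
rewrite mulnSr exprD -mulmxE mulmxA.
apply: (le_trans (l1norm_contract (stochastic_expr stP _) (ltW e0) eP (sumk _))).
(* As [n >= 1], the factor [1 - e *+ n] is at most [1 - e], which lies in [0, 1). *)
rewrite exprS mulrCA; apply: (@le_trans _ _ ((1 - e) * l1norm (v *m P ^+ (m.+1 * j)))).
  rewrite ler_wpM2r // lerD2l lerN2 -[leLHS]mulr1n.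
  by rewrite ler_wpMn2l // ltW.
by rewrite ler_wpM2l ?subr_ge0.
Qed.

Lemma invariant_expr (pi : 'rV[R]_n) k : pi *m P = pi -> pi *m P ^+ k = pi.
Proof.
move=> piP; elim: k => [|k IH]; first by rewrite expr0 mulmx1.
by rewrite exprS -mulmxE mulmxA piP.
Qed.

(** Row [x] of [P ^+ k] minus [pi] is the image under [P ^+ k] of [delta_mx 0 x - pi], a vector of
    sum zero. *)
Lemma primitive_converges (pi : 'rV[R]_n) :
  invariant_distribution P pi -> converges_from_every_state P pi.
Proof.
move=> [[_ pi1] piP] x z.
have v0 : \sum_y (delta_mx 0 x - pi) 0 y = 0.
  under eq_bigr do rewrite !mxE eqxx.
  rewrite sumrB pi1 (bigD1 x) //= eqxx big1 ?addr0 ?subrr // => y.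
  by move/negbTE ->.
have n0 : (0 < n)%N by apply: leq_ltn_trans (ltn_ord x).
have cv : `|(P ^+ k) x z - pi 0 z| @[k --> \oo] --> (0 : R).
  apply: squeeze_cvgr (cvg_cst 0) (l1norm_expr_cvg0 n0 v0).
  apply: nearW => k; rewrite normr_ge0 /=.
  rewrite mulmxBl (invariant_expr _ piP) -rowE /l1norm (bigD1 z) //= !mxE.
  by rewrite lerDl sumr_ge0.
by apply/subr_cvg0; exact: norm_cvg0 cv.
Qed.

(* A left fixed vector v exists because P - 1 kills the constant column.  Then
   |v| <= |v| P entrywise and both sides have the same sum, so |v| is fixed. *)
Lemma stochastic_invariant_exists :
  (0 < n)%N -> exists pi : 'rV[R]_n, invariant_distribution P pi.
Proof.
move=> n0.
have /det0P[v v0 vP] : \det (P - 1%:M) == 0.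
  rewrite -det_tr; apply/det0P; exists (const_mx 1).
    apply/eqP => /rowP/(_ (Ordinal n0)); rewrite !mxE => /eqP.
    by rewrite oner_eq0.
  apply/rowP => x; rewrite !mxE; under eq_bigr do rewrite !mxE mul1r.
  rewrite sumrB stP.2 (bigD1 x) //= eqxx big1 ?addr0 ?subrr // => y yx.
  by rewrite eq_sym (negbTE yx).
have {}vP : v *m P = v.
  by apply/eqP; rewrite -subr_eq0 -{2}[v]mulmx1 -mulmxBr vP.
pose w : 'rV[R]_n := \row_x `|v 0 x|.
have wP x : w 0 x <= (w *m P) 0 x.
  rewrite mxE -{1}vP mxE (le_trans (ler_norm_sum _ _ _)) // mxE.
  by apply: ler_sum => y _; rewrite normrM mxE [`|P _ _|]ger0_norm ?stP.1.
have {}wP : w *m P = w.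
  apply/rowP => x; apply/eqP; rewrite -subr_eq0; apply/eqP.
  apply: (psumr_eq0P (P := xpredT)
    (F := fun x => (w *m P) 0 x - w 0 x)) => //.
    by move=> y _; rewrite subr_ge0.
  by rewrite sumrB sum_mulmx_stochastic ?subrr.
have w0 x : 0 <= w 0 x by rewrite mxE.
have ws : \sum_x w 0 x != 0.
  apply: contra v0 => /eqP ws; apply/eqP/rowP => x; apply/eqP.
  have := psumr_eq0P (fun x _ => w0 x) ws (i := x) isT.
  by rewrite !mxE => /eqP; rewrite normr_eq0.
exists ((\sum_x w 0 x)^-1 *: w); split; last by rewrite -scalemxAl wP.
split=> [x|]; first by rewrite mxE mulr_ge0 ?invr_ge0 ?sumr_ge0.
under eq_bigr do rewrite mxE.
by rewrite -mulr_sumr mulVf.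
Qed.

(** Two invariant distributions are limits of the same sequences, here those started at state 0. *)
Lemma primitive_invariant_unique :
  (0 < n)%N -> exists! pi : 'rV[R]_n, invariant_distribution P pi.
Proof.
move=> n0; have [pi piP] := stochastic_invariant_exists n0.
exists pi; split=> // pi' pi'P; apply/rowP => z.
have cv : converges_from_every_state P pi by apply: primitive_converges.
have cv' : converges_from_every_state P pi' by apply: primitive_converges.
exact: (cvg_unique (@Rhausdorff R) (cv (Ordinal n0) z) (cv' (Ordinal n0) z)).
Qed.

End Convergence.

(** * Primitivity of the involutive walk *)

Section Walk.
Variables (R : realType) (n : nat) (D : weight_domain) (gamma : weight R D).
Hypothesis hD : forall x : nat, (x < n)%N -> in_domain D x.

Local Notation P := (involutive_walk gamma n).

Lemma involutive_walk_gt0 (x y : 'I_n) : 0 < gamma y x -> 0 < P x (rev_ord y).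
Proof.
by move=> yx; rewrite mxE rev_ordK divr_gt0 // wt_sum_gt0 // hD.
Qed.

Lemma involutive_walk_stochastic : stochastic P.
Proof.
have tot0 (x : 'I_n) : 0 < weight_total gamma x by rewrite wt_sum_gt0 ?hD.
split=> [x z|x].
  rewrite mxE divr_ge0 ?(ltW (tot0 x)) //.
  by have [zx|xz] := leqP (rev_ord z) x; [rewrite wt_ge0 ?hD | rewrite wt_empty].
under eq_bigr do rewrite mxE.
(* Reindexing by the involution makes the row sum a sum of [gamma y x] over [y < n]; the terms with
   [y > x] vanish, leaving [weight_total gamma x]. *)
rewrite -mulr_suml (reindex_inj rev_ord_inj) /=.
under eq_bigr do rewrite -[(n - _)%N]/(val (rev_ord (rev_ord _))) rev_ordK.
rewrite -(big_mkord xpredT (fun y => gamma y x)).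
rewrite (big_cat_nat (n := x.+1)) //= [X in _ + X]big_nat_cond.
rewrite [X in _ + X]big1 ?addr0; first exact: divff (lt0r_neq0 (tot0 x)).
by move=> y /andP[/andP[xy _] _]; rewrite wt_empty.
Qed.

Let stP := involutive_walk_stochastic.

Lemma endpoint_weights_primitive :
  (0 < n)%N ->
  (forall x : nat, (x < n)%N -> 0 < gamma 0%N x /\ 0 < gamma x n.-1) ->
  exists m, forall x z, 0 < (P ^+ m.+1) x z.
Proof.
(* Two steps suffice: choosing 0 leads from [x] to [n-1], and choosing [rev_ord z] leads from there
   to [z]. *)
move=> n0 h; exists 1%N => x z.
pose o0 : 'I_n := Ordinal n0.
have step1 : 0 < (P ^+ 1) x (rev_ord o0).
  by rewrite expr1 involutive_walk_gt0 //; exact: (h _ (ltn_ord x)).1.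
apply: (expr_gt0D stP step1 (k := 1)); rewrite expr1 -[z]rev_ordK.
by rewrite involutive_walk_gt0 //= subn1; exact: (h _ (ltn_ord (rev_ord z))).2.
Qed.

(* x -> (x-1)* -> x-1 and x -> x* -> (x*-1)* = x+1 link neighbouring states,
   and the middle state has a loop. *)
Lemma diagonal_weights_primitive :
  (0 < n)%N ->
  (forall x : nat, (x < n)%N -> 0 < gamma x x) ->
  (forall x : nat, (0 < x)%N -> (x < n)%N -> 0 < gamma x.-1 x) ->
  exists m, forall x z, 0 < (P ^+ m.+1) x z.
Proof.
move=> n0 hdiag hsub.
have stay (x : 'I_n) : 0 < (P ^+ 1) x (rev_ord x).
  by rewrite expr1 involutive_walk_gt0 // hdiag.
have shift (x y : 'I_n) : x = y.+1 :> nat -> 0 < (P ^+ 1) x (rev_ord y).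
  move=> xy; rewrite expr1 involutive_walk_gt0 //.
  by have := hsub x; rewrite xy => /(_ isT); apply; rewrite -xy.
have down (x y : 'I_n) : x = y.+1 :> nat -> 0 < (P ^+ 2) x y.
  move=> xy; apply: (expr_gt0D stP (j := 1) (k := 1) (shift x y xy)).
  by have := stay (rev_ord y); rewrite rev_ordK.
have up (x y : 'I_n) : x = y.+1 :> nat -> 0 < (P ^+ 2) y x.
  move=> xy; apply: (expr_gt0D stP (j := 1) (k := 1) (stay y)).
  have := shift (rev_ord y) (rev_ord x); rewrite rev_ordK; apply => /=.
  by have := ltn_ord x; lia.
(* Paths to and from state 0 suffice, since any two states can then be joined through 0. *)
have linked j (jn : (j < n)%N) :
    (exists k, 0 < (P ^+ k) (Ordinal jn) (Ordinal n0)) /\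
    (exists k, 0 < (P ^+ k) (Ordinal n0) (Ordinal jn)).
  elim: j jn => [|j IH] jn.
    by rewrite (bool_irrelevance jn n0); split; exists 0%N; rewrite expr0 mxE eqxx.
  have [[k kP] [l lP]] := IH (ltnW jn); split.
    by exists (2 + k)%N; apply: (expr_gt0D stP (down _ _ _) kP).
  by exists (l + 2)%N; apply: (expr_gt0D stP lP (up _ _ _)).
have irr : irreducible P.
  move=> [x xn] [z zn].
  have [[k kP] _] := linked x xn; have [_ [l lP]] := linked z zn.
  by exists (k + l)%N; apply: expr_gt0D kP lP.
have cn : (n./2 < n)%N by lia.
apply: (irreducible_loop_primitive stP (c := Ordinal cn) irr); rewrite -[P]expr1.
(* For odd [n] the state [n./2] is its own image, so choosing it gives the loop. For even [n] the
   image of [n./2.-1] is [n./2], so the loop comes from choosing [n./2.-1]. *)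
have [nodd|neven] := boolP (odd n).
  have := stay (Ordinal cn).
  suff -> : rev_ord (Ordinal cn) = Ordinal cn by [].
  by apply: val_inj => /=; lia.
have bn : (n./2.-1 < n)%N by lia.
have := shift (Ordinal cn) (Ordinal bn).
suff -> : rev_ord (Ordinal bn) = Ordinal cn by apply=> /=; lia.
by apply: val_inj => /=; lia.
Qed.

End Walk.

Theorem theorem1p3 (R : realType) (n : nat) (hn : (1 <= n)%N)
    (D : weight_domain) (gamma : weight R D)
    (hD : forall x : nat, (x < n)%N -> in_domain D x)
    (hgamma :
      (forall x : nat, (x < n)%N -> 0 < gamma 0%N x /\ 0 < gamma x n.-1) \/
      ((forall x : nat, (x < n)%N -> 0 < gamma x x) /\
       (forall x : nat, (0 < x)%N -> (x < n)%N -> 0 < gamma x.-1 x))) :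
  [/\ irreducible (involutive_walk gamma n),
      recurrent (involutive_walk gamma n),
      ergodic (involutive_walk gamma n),
      exists! pi : 'rV[R]_n,
        invariant_distribution (involutive_walk gamma n) pi
    & forall pi : 'rV[R]_n,
        invariant_distribution (involutive_walk gamma n) pi ->
        converges_from_every_state (involutive_walk gamma n) pi].
Proof.
have stP := involutive_walk_stochastic gamma hD.
have [m Pm] : exists m, forall x z, 0 < (involutive_walk gamma n ^+ m.+1) x z.
  case: hgamma => [h|[hdiag hsub]]; first exact: endpoint_weights_primitive.
  exact: diagonal_weights_primitive.
have erg := primitive_ergodic stP Pm.
split.
- exact: erg.1.
- exact: primitive_recurrent Pm.
- exact: erg.
- exact: primitive_invariant_unique Pm hn.
- by move=> pi; apply: primitive_converges Pm _.
Qed.
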